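(* Let $F$ be a field and let $S\subseteq M_n(F)$ be a right-handed skew lattice in the matrix ring $M_n(F)$ with exactly two $\mathcal{D}$-classes $A>B$, written in standard block form, so that every $u\in A$ and every $v\in B$ have the form $$u=\begin{bmatrix} I&0&z\\0&I&w\\0&0&0\end{bmatrix},\qquad v=\begin{bmatrix} I&x&y\\0&0&0\\0&0&0\end{bmatrix}.$$ Let $u\in A$, with blocks $z,w$, and $v\in B$, with blocks $x,y$. Then: (i) $S$ is normal if and only if for all $v'\,\mathcal{D}\,v$, with blocks $x',y'$ (i.e. $v'=\begin{bmatrix} I&x'&y'\\0&0&0\\0&0&0\end{bmatrix}$), one has $x=x'$. (ii) $S$ is conormal if and only if for all $u'\,\mathcal{D}\,u$, with blocks $z',w'$ (i.e. $u'=\begin{bmatrix} I&0&z'\\0&I&w'\\0&0&0\end{bmatrix}$), one has $w=w'$.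
   Context: A skew lattice is a set $S$ with associative idempotent binary operations $\wedge,\vee$ satisfying $x\wedge(x\vee y)=x=(y\vee x)\wedge x$ and the duals $x\vee(x\wedge y)=x=(y\wedge x)\vee x$. Natural preorder: $x\succeq y$ iff $y\wedge x\wedge y=y$; $x\,\mathcal{D}\,y$ iff $x\succeq y$ and $y\succeq x$. $\mathcal{D}$ is a congruence, $S/\mathcal{D}$ is a lattice, and for $\mathcal{D}$-classes $A>B$ refers to the order of $S/\mathcal{D}$. $S$ is normal if $(S;\wedge)$ satisfies $x\wedge y\wedge z\wedge w=x\wedge z\wedge y\wedge w$, and conormal if $(S;\vee)$ satisfies $x\vee y\vee z\vee w=x\vee z\vee y\vee w$. $S$ is right-handed if Green's relation $\mathcal{R}$ of $(S;\wedge)$ equals $\mathcal{D}$, i.e. $x\wedge y\wedge x=y\wedge x$ and $x\vee y\vee x=x\vee y$ hold. For a ring $R$, a skew lattice in $R$ is a set $S$ of idempotents of $R$ closed under multiplication and $x\nabla y=(x+y-xy)^2$ which is a skew lattice under $x\wedge y=xy$, $x\vee y=x\nabla y$. For right-handed skew lattices $\nabla$ reduces to $x\circ y=x+y-xy$. Standard form (known): for a right-handed skew lattice in $M_n(F)$ with $\mathcal{D}$-classes $A>B$ there is a basis of $F^n$ and a block decomposition (the same for all elements, square diagonal blocks, $I$ denoting identity blocks) in which all elements of $A$ and $B$ have the displayed forms. *)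

(* Defs.v *)
From HB Require Import structures.
From mathcomp Require Import all_boot all_order all_algebra.
Set Implicit Arguments.
Unset Strict Implicit.
Unset Printing Implicit Defensive.
Import GRing.Theory.
Local Open Scope ring_scope.

(* Skew lattices are carried by a subset S of an ambient type T: the binary
   operations are total on T, but all axioms and relations are relative to S. *)

Definition closed_under (T : Type) (S : T -> Prop) (op : T -> T -> T) : Prop :=
  forall x y, S x -> S y -> S (op x y).

Definition band_on (T : Type) (S : T -> Prop) (op : T -> T -> T) : Prop :=
  [/\ closed_under S op,
      forall x y z, S x -> S y -> S z -> op x (op y z) = op (op x y) z
    & forall x, S x -> op x x = x].

Definition skew_lattice_on (T : Type) (S : T -> Prop) (meet join : T -> T -> T)
    : Prop :=
  [/\ band_on S meet,
      band_on S join,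
      forall x y, S x -> S y ->
        meet x (join x y) = x /\ meet (join y x) x = x
    & forall x y, S x -> S y ->
        join x (meet x y) = x /\ join (meet y x) x = x].

(* npreorder meet x y is x >= y in the natural preorder: x is the larger one. *)
Definition npreorder (T : Type) (meet : T -> T -> T) (x y : T) : Prop :=
  meet (meet y x) y = y.

Definition Drel (T : Type) (meet : T -> T -> T) (x y : T) : Prop :=
  npreorder meet x y /\ npreorder meet y x.

Definition Dclass (T : Type) (S : T -> Prop) (meet : T -> T -> T)
    (C : T -> Prop) : Prop :=
  exists2 x, S x & forall y, C y <-> S y /\ Drel meet y x.

(* The strict order of the quotient S/D, on D-classes A and B. *)
Definition Dclass_gt (T : Type) (meet : T -> T -> T) (A B : T -> Prop) : Prop :=
  forall a b, A a -> B b -> npreorder meet a b /\ ~ npreorder meet b a.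

Definition two_Dclasses (T : Type) (S : T -> Prop) (meet : T -> T -> T)
    (A B : T -> Prop) : Prop :=
  [/\ Dclass S meet A, Dclass S meet B, Dclass_gt meet A B
    & forall x, S x -> A x \/ B x].

(* x y z t |-> x y z t = x z y t; with op := meet this is normality of S, and
   with op := join it is conormality of S. *)
Definition middle_commutative (T : Type) (S : T -> Prop) (op : T -> T -> T)
    : Prop :=
  forall x y z t, S x -> S y -> S z -> S t ->
    op (op (op x y) z) t = op (op (op x z) y) t.

Definition right_handed (T : Type) (S : T -> Prop) (meet join : T -> T -> T)
    : Prop :=
  forall x y, S x -> S y ->
    meet (meet x y) x = meet y x /\ join (join x y) x = join x y.

(* Green's relation R of the semigroup (S; op): x and y generate the same
   principal right ideal. *)
Definition greenR (T : Type) (S : T -> Prop) (op : T -> T -> T) (x y : T)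
    : Prop :=
  (x = y \/ exists2 s, S s & x = op y s) /\
  (y = x \/ exists2 s, S s & y = op x s).

Lemma right_handed_greenR (T : Type) (S : T -> Prop) (meet join : T -> T -> T) :
  skew_lattice_on S meet join ->
  right_handed S meet join <->
  (forall x y, S x -> S y -> greenR S meet x y <-> Drel meet x y).
Proof.
case=> -[cm am im] [cj aj ij] a1 a2.
have gR x y : S x -> S y -> greenR S meet x y -> meet x y = y /\ meet y x = x.
  move=> Sx Sy [h1 h2]; split.
    by case: h2 => [->|[s Ss ->]]; [exact: im | rewrite am // im].
  by case: h1 => [->|[s Ss ->]]; [exact: im | rewrite am // im].
split=> [rh x y Sx Sy | RD x y Sx Sy].
  split=> [/(gR _ _ Sx Sy)[xy yx]|[]].
    by rewrite /Drel /npreorder xy yx xy.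
  rewrite /npreorder => h1 h2; split; right.
    by exists x => //; have [<- _] := rh x y Sx Sy.
  by exists y => //; have [<- _] := rh y x Sy Sx.
have key a b : S a -> S b -> meet a b = a -> meet b a = b -> a = b.
  move=> Sa Sb ab ba.
  have /(gR _ _ Sa Sb)[] : greenR S meet a b; last by rewrite ab.
  by apply/RD => //; rewrite /Drel /npreorder ab ba !im.
have Sxy := cm _ _ Sx Sy; have Syx := cm _ _ Sy Sx.
have Jxy := cj _ _ Sx Sy; have Jyx := cj _ _ Sy Sx.
split.
  have Sxyx := cm _ _ Sxy Sx.
  have yxx : meet (meet y x) x = meet y x by rewrite -am // im.
  have xyE : meet (meet x y) x = meet x (meet y x) by rewrite am.
  have e1 : meet (meet (meet x y) x) (meet y x) = meet (meet x y) x.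
    by rewrite xyE -am // im.
  have e2 : meet (meet y x) (meet (meet x y) x) = meet y x.
    by rewrite xyE am // yxx im.
  have : greenR S meet (meet (meet x y) x) (meet y x).
    by apply/RD => //; rewrite /Drel /npreorder e1 e2 !im.
  by move=> /(gR _ _ Sxyx Syx)[]; rewrite e1.
have Jxyx := cj _ _ Jxy Sx.
apply: key => //.
  have {2}<- : join (join (join x y) x) (join x y) = join x y.
    by rewrite aj // -(aj (join x y) x x) // ij // -aj // ij.
  by have [] := a1 (join (join x y) x) (join x y).
by have [] := a1 (join x y) x.
Qed.

Definition nabla (R : pzRingType) (x y : R) : R := (x + y - x * y) ^+ 2.

Definition ring_skew_lattice (R : pzRingType) (S : R -> Prop) : Prop :=
  (forall x, S x -> x * x = x) /\ skew_lattice_on S *%R (@nabla R).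

Definition ring_right_handed (R : pzRingType) (S : R -> Prop) : Prop :=
  right_handed S *%R (@nabla R).

Definition ring_D (R : pzRingType) (x y : R) : Prop := Drel *%R x y.

Definition ring_two_Dclasses (R : pzRingType) (S A B : R -> Prop) : Prop :=
  two_Dclasses S *%R A B.

Definition ring_normal (R : pzRingType) (S : R -> Prop) : Prop :=
  middle_commutative S *%R.

Definition ring_conormal (R : pzRingType) (S : R -> Prop) : Prop :=
  middle_commutative S (@nabla R).

Definition block3_mx (F : pzRingType) (p q r : nat)
    (a11 : 'M[F]_(p, p)) (a12 : 'M[F]_(p, q)) (a13 : 'M[F]_(p, r))
    (a21 : 'M[F]_(q, p)) (a22 : 'M[F]_(q, q)) (a23 : 'M[F]_(q, r))
    (a31 : 'M[F]_(r, p)) (a32 : 'M[F]_(r, q)) (a33 : 'M[F]_(r, r))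
    : 'M[F]_(p + (q + r)) :=
  block_mx a11 (row_mx a12 a13) (col_mx a21 a31) (block_mx a22 a23 a32 a33).

(* The standard forms of the elements of the upper class A and of the lower
   class B; I is the p x p, resp. q x q, identity block. *)
Definition upper_form (F : pzRingType) (p q r : nat)
    (z : 'M[F]_(p, r)) (w : 'M[F]_(q, r)) : 'M[F]_(p + (q + r)) :=
  block3_mx 1%:M 0    z
            0    1%:M w
            0    0    0.

Definition lower_form (F : pzRingType) (p q r : nat)
    (x : 'M[F]_(p, q)) (y : 'M[F]_(p, r)) : 'M[F]_(p + (q + r)) :=
  block3_mx 1%:M x y
            0    0 0
            0    0 0.

(* Main.v *)
(* In block form a product of two elements of S is its right factor, except
   that lower_form x y * upper_form z w = lower_form x (z + x *m w); dually
   nabla returns its left argument, except that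
   nabla (lower_form x y) (upper_form z w) = upper_form (y - x *m w) w.
   Hence a product with last factor in A and some earlier factor in B remembers
   of those earlier factors only the x-block of the last one from B, and a join
   with first argument in B and some later argument in A remembers of those
   later arguments only the w-block of the first one from A. *)
Require Import Defs.
From HB Require Import structures.
From mathcomp Require Import all_boot all_order all_algebra.
Set Implicit Arguments.
Unset Strict Implicit.
Unset Printing Implicit Defensive.
Import GRing.Theory.
Local Open Scope ring_scope.

Section StandardForms.

Variables (F : pzRingType) (p q r : nat).
Implicit Types (x : 'M[F]_(p, q)) (y z : 'M[F]_(p, r)) (w : 'M[F]_(q, r)).

Lemma block3_mulmx
    (a11 b11 : 'M[F]_(p, p)) (a12 b12 : 'M[F]_(p, q)) (a13 b13 : 'M[F]_(p, r))
    (a21 b21 : 'M[F]_(q, p)) (a22 b22 : 'M[F]_(q, q)) (a23 b23 : 'M[F]_(q, r))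
    (a31 b31 : 'M[F]_(r, p)) (a32 b32 : 'M[F]_(r, q)) (a33 b33 : 'M[F]_(r, r)) :
  block3_mx a11 a12 a13 a21 a22 a23 a31 a32 a33 *
  block3_mx b11 b12 b13 b21 b22 b23 b31 b32 b33 =
  block3_mx
    (a11 *m b11 + (a12 *m b21 + a13 *m b31))
    (a11 *m b12 + (a12 *m b22 + a13 *m b32))
    (a11 *m b13 + (a12 *m b23 + a13 *m b33))
    (a21 *m b11 + (a22 *m b21 + a23 *m b31))
    (a21 *m b12 + (a22 *m b22 + a23 *m b32))
    (a21 *m b13 + (a22 *m b23 + a23 *m b33))
    (a31 *m b11 + (a32 *m b21 + a33 *m b31))
    (a31 *m b12 + (a32 *m b22 + a33 *m b32))
    (a31 *m b13 + (a32 *m b23 + a33 *m b33)).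
Proof.
rewrite /block3_mx -[LHS]/(_ *m _) mulmx_block mul_row_block mul_block_col.
rewrite mulmx_block mul_row_col mul_col_row mul_mx_row mul_col_mx.
by rewrite add_block_mx add_row_mx add_col_mx.
Qed.

Let mul0E := (mul1mx, mul0mx, mulmx0, mulmx1, add0r, addr0).

Lemma upper_form_mul z w z' w' :
  upper_form z w * upper_form z' w' = upper_form z' w'.
Proof. by rewrite block3_mulmx !mul0E. Qed.

Lemma upper_lower_form_mul z w x y :
  upper_form z w * lower_form x y = lower_form x y.
Proof. by rewrite block3_mulmx !mul0E. Qed.

Lemma lower_upper_form_mul x y z w :
  lower_form x y * upper_form z w = lower_form x (z + x *m w).
Proof. by rewrite block3_mulmx !mul0E. Qed.

Lemma lower_form_mul x y x' y' :
  lower_form x y * lower_form x' y' = lower_form x' y'.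
Proof. by rewrite block3_mulmx !mul0E. Qed.

(** The product equals the right argument and cancels it in the sum, so only the left argument is
    left; being idempotent, it survives the square. *)
Lemma upper_form_nabla z w z' w' :
  nabla (upper_form z w) (upper_form z' w') = upper_form z w.
Proof. by rewrite /nabla upper_form_mul addrK expr2 upper_form_mul. Qed.

Lemma upper_lower_form_nabla z w x y :
  nabla (upper_form z w) (lower_form x y) = upper_form z w.
Proof. by rewrite /nabla upper_lower_form_mul addrK expr2 upper_form_mul. Qed.

Lemma lower_form_nabla x y x' y' :
  nabla (lower_form x y) (lower_form x' y') = lower_form x y.
Proof. by rewrite /nabla lower_form_mul addrK expr2 lower_form_mul. Qed.

Lemma lower_upper_form_nabla x y z w :
  nabla (lower_form x y) (upper_form z w) = upper_form (y - x *m w) w.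
Proof.
rewrite /nabla lower_upper_form_mul.
(* Before squaring, the expression already has upper form, hence is idempotent and equals its
   square. *)
suff -> : lower_form x y + upper_form z w - lower_form x (z + x *m w)
        = upper_form (y - x *m w) w by rewrite expr2 upper_form_mul.
rewrite /lower_form /upper_form /block3_mx !(opp_block_mx, opp_row_mx).
rewrite !(opp_col_mx, add_block_mx, add_row_mx, add_col_mx) !oppr0 !addr0 !add0r.
by rewrite addrK subrr opprD addrA addrK.
Qed.

Lemma lower_form_inj x y x' y' :
  lower_form x y = lower_form x' y' -> x = x'.
Proof. by move=> /eq_block_mx[_ /eq_row_mx[]]. Qed.

Lemma upper_form_inj z w z' w' :
  upper_form z w = upper_form z' w' -> w = w'.
Proof. by move=> /eq_block_mx[_ _ _ /eq_block_mx[]]. Qed.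

End StandardForms.

Definition form_mul :=
  (upper_form_mul, upper_lower_form_mul, lower_upper_form_mul, lower_form_mul).

Definition form_nabla :=
  (upper_form_nabla, upper_lower_form_nabla, lower_upper_form_nabla,
   lower_form_nabla).

Theorem proposition21 (F : fieldType) (p q r : nat)
  (S A B : 'M[F]_(p + (q + r)) -> Prop)
  (S_skew : ring_skew_lattice S)
  (S_rh : ring_right_handed S)
  (S_AB : ring_two_Dclasses S A B)
  (A_std : forall u, A u -> exists z w, u = upper_form z w)
  (B_std : forall v, B v -> exists x y, v = lower_form x y)
  (u v : 'M[F]_(p + (q + r))) (Au : A u) (Bv : B v)
  (z : 'M[F]_(p, r)) (w : 'M[F]_(q, r)) (u_def : u = upper_form z w)
  (x : 'M[F]_(p, q)) (y : 'M[F]_(p, r)) (v_def : v = lower_form x y) :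
  (ring_normal S <->
     forall v' : 'M[F]_(p + (q + r)), S v' -> ring_D v' v ->
     forall (x' : 'M[F]_(p, q)) (y' : 'M[F]_(p, r)),
       v' = lower_form x' y' -> x = x')
  /\
  (ring_conormal S <->
     forall u' : 'M[F]_(p + (q + r)), S u' -> ring_D u' u ->
     forall (z' : 'M[F]_(p, r)) (w' : 'M[F]_(q, r)),
       u' = upper_form z' w' -> w = w').
Proof.
case: S_AB => -[a0 _ defA] [b0 _ defB] _ coverS.
have SA a : A a -> S a by move=> /defA[].
have SB b : B b -> S b by move=> /defB[].
subst u v; split; split.
- move=> normS v' Sv' [v'v vv'] x' y' v'_def; subst v'.
  (* In [u v v' u] the last factor from [B] is [v'], in [u v' v u] it is [v]; the final [u]
     preserves their x-blocks, so these must agree. *)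
  have := normS _ _ _ _ (SA _ Au) (SB _ Bv) Sv' (SA _ Au).
  by rewrite !form_mul => /lower_form_inj.
- move=> eq_x.
  (* Any two lower forms multiply to the right factor, so [b] is D-related to [v] and the hypothesis
     gives it the block [x]. *)
  have stdB b : B b -> exists y', b = lower_form x y'.
    move=> Bb; have [x' [y' b_def]] := B_std _ Bb; exists y'.
    have bDv : ring_D b (lower_form x y).
      by rewrite b_def /ring_D /Drel /npreorder !form_mul.
    by rewrite b_def (eq_x _ (SB _ Bb) bDv _ _ b_def).
  have stdS s : S s ->
      (exists z' w', s = upper_form z' w') \/ (exists y', s = lower_form x y').
    by move=> /coverS[/A_std|/stdB]; [left | right].
  move=> a b c d /stdS Sa /stdS Sb /stdS Sc /stdS Sd.
  (* With a common [x], the product is [d] or, when [d] has upper form and some earlier factor has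
     lower form, [lower_form x (z + x *m w)] with [z], [w] the blocks of [d]. Neither depends on the
     order of [b] and [c]. *)
  by case: Sa Sb Sc Sd => [[? [? ->]]|[? ->]] [[? [? ->]]|[? ->]]
    [[? [? ->]]|[? ->]] [[? [? ->]]|[? ->]]; rewrite !form_mul.
- move=> conormS u' Su' [u'u uu'] z' w' u'_def; subst u'.
  (* Joining [v] first with [u] or first with [u'] fixes the w-block as [w] or [w'], and the later
     joins leave it unchanged. *)
  have := conormS _ _ _ _ (SB _ Bv) (SA _ Au) Su' (SA _ Au).
  by rewrite !form_nabla => /upper_form_inj.
- move=> eq_w.
  have stdA a : A a -> exists z', a = upper_form z' w.
    move=> Aa; have [z' [w' a_def]] := A_std _ Aa; exists z'.
    have aDu : ring_D a (upper_form z w).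
      by rewrite a_def /ring_D /Drel /npreorder !form_mul.
    by rewrite a_def (eq_w _ (SA _ Aa) aDu _ _ a_def).
  have stdS s : S s ->
      (exists z', s = upper_form z' w) \/ (exists x' y', s = lower_form x' y').
    by move=> /coverS[/stdA|/B_std]; [left | right].
  move=> a b c d /stdS Sa /stdS Sb /stdS Sc /stdS Sd.
  (* With a common [w], the join is [a], or [upper_form (y - x *m w) w] with [x], [y] the blocks of
     [a]; swapping [b] and [c] changes nothing. *)
  by case: Sa Sb Sc Sd => [[? ->]|[? [? ->]]] [[? ->]|[? [? ->]]]
    [[? ->]|[? [? ->]]] [[? ->]|[? [? ->]]]; rewrite !form_nabla.
Qed.
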